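(* Let $T>0$, let $d,e\ge1$ be integers, let $p\ge1$ and $0<\alpha\le1$ satisfy $\alpha+1/p>1$, and let $x\in\mathcal{H}^\alpha([0,T]\to\mathbb{R}^d)$. Then the map $$\mathbf{V}^p([0,T]\to\mathbb{R}^{e\times d})\ni v\longmapsto\int_0^\cdot v\,\mathrm{d}x\in\mathcal{H}^\alpha([0,T]\to\mathbb{R}^e)$$ is continuous when its domain is endowed with the distance $d_{\mathsf{S},V_p}$ and its target with the norm $\|\cdot\|_{H_\beta}$, for any $0<\beta<\alpha$.
   Context: For a path $x$ on $[0,T]$ with values in a normed space, and $p\ge 1$, $0<\alpha\le 1$: $V_p(x)=\sup\big(\sum_{k=1}^n|x_{\sigma_k}-x_{\sigma_{k-1}}|^p\big)^{1/p}$, the supremum being over all finite sets $\sigma_0<\dots<\sigma_n$ in $[0,T]$; $H_\alpha(x)=\sup_{s\ne t}|x_t-x_s|/|t-s|^\alpha$; $\|x\|_{V_p}=\|x\|_\infty+V_p(x)$; $\|x\|_{H_\alpha}=\|x\|_\infty+H_\alpha(x)$. $\mathcal{H}^\alpha$ is the space of paths with $H_\alpha(x)<\infty$; $\mathbf{V}^p$ is the space of càdlàg (right-continuous with left limits) paths with $V_p(x)<\infty$. Let $\Lambda$ be the set of strictly increasing bijections $\lambda:[0,T]\to[0,T]$ and, for $\lambda\in\Lambda$, $\|\lambda\|_\circ=\sup_{t\ne s\in[0,T]}\big|\log\frac{\lambda(t)-\lambda(s)}{t-s}\big|\in[0,\infty]$. The Skorokhod-type distance is $$d_{\mathsf{S},V_p}(x,y)=\inf_{\lambda\in\Lambda}\max\big(\|\lambda\|_\circ,\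 \|x-y\circ\lambda\|_{V_p}\big).$$ $\int_0^t v\,\mathrm{d}x$ is the Young integral: the limit of $\sum_k v_{\sigma_{k-1}}(x_{\sigma_k}-x_{\sigma_{k-1}})$ over subdivisions $0=\sigma_0<\dots<\sigma_n=t$ as the mesh tends to $0$ (it exists since $\alpha+1/p>1$), and $\int_0^\cdot v\,\mathrm{d}x$ denotes the path $t\mapsto\int_0^t v\,\mathrm{d}x$, which is $\alpha$-Hölder. *)

(* Defs.v *)
From HB Require Import structures.
From mathcomp Require Import all_boot all_order all_algebra.
From mathcomp Require Import all_classical all_reals all_analysis.

Set Implicit Arguments.
Unset Strict Implicit.
Unset Printing Implicit Defensive.

Import Order.TTheory GRing.Theory Num.Theory.
Import numFieldNormedType.Exports.

Local Open Scope classical_set_scope.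
Local Open Scope ring_scope.

(* A path on [0, T] is a total function R -> V of which only the values on
   `[0, T] are ever used.  Suprema are taken in \bar R, so that they may be
   +oo.  When V is a space of matrices, `|.| is the library's norm, the largest
   absolute value of an entry; the topologies defined below do not depend on
   the choice of a norm on such a V. *)

Section paths.
Context {R : realType} {V : normedModType R}.
Implicit Types (T p a : R) (x y : R -> V) (lam : R -> R).

Definition sup_norm T x : \bar R :=
  ereal_sup [set `|x t|%:E | t in `[0, T]].

Definition p_variation T p x : \bar R :=
  ereal_sup [set r | exists (n : nat) (sigma : nat -> R),
    [/\ forall k, (k <= n)%N -> sigma k \in `[0, T],
        forall k, (k < n)%N -> sigma k < sigma k.+1 &
        r = ((\sum_(0 <= k < n)
               `|x (sigma k.+1) - x (sigma k)| `^ p) `^ p^-1)%:E]].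

Definition holder_const T a x : \bar R :=
  ereal_sup [set r | exists s t,
    [/\ s \in `[0, T], t \in `[0, T], s != t &
        r = (`|x t - x s| / `|t - s| `^ a)%:E]].

Definition var_norm T p x : \bar R := (sup_norm T x + p_variation T p x)%E.

Definition holder_norm T a x : \bar R := (sup_norm T x + holder_const T a x)%E.

Definition cadlag T x : Prop :=
  (forall t, 0 <= t < T -> x s @[s --> t^'+] --> x t) /\
  (forall t, 0 < t <= T -> cvg (x s @[s --> t^'-])).

Definition holder_space T a : set (R -> V) :=
  [set x | (holder_const T a x < +oo)%E].

Definition var_space T p : set (R -> V) :=
  [set x | cadlag T x /\ (p_variation T p x < +oo)%E].

Definition time_change T : set (R -> R) :=
  [set lam | set_bij `[0, T] `[0, T] lam /\
             {in `[0, T] &, {homo lam : s t / s < t}}].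

Definition time_change_norm T lam : \bar R :=
  ereal_sup [set r | exists s t,
    [/\ s \in `[0, T], t \in `[0, T], s != t &
        r = `|ln ((lam t - lam s) / (t - s))|%:E]].

Definition skorokhod_dist T p x y : \bar R :=
  ereal_inf [set maxe (time_change_norm T lam)
                      (var_norm T p (fun t => x t - y (lam t)))
            | lam in time_change T].

End paths.

Section young.
Context {R : realType} {d e : nat}.
Implicit Types (v : R -> 'M[R]_(e, d)) (x : R -> 'cV[R]_d) (t : R).

(* As in itv_partition, the subdivision 0 = sigma_0 < ... < sigma_n = t is
   encoded by the sequence s of sigma_1, ..., sigma_n (empty when t = 0). *)
Definition young_sum v x (s : seq R) : 'cV[R]_e :=
  \sum_(0 <= k < size s)
    v (nth 0 (0 :: s) k) *m (x (nth 0 (0 :: s) k.+1) - x (nth 0 (0 :: s) k)).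

Definition fine_partition t (delta : R) : set (seq R) :=
  [set s | itv_partition 0 t s /\ forall k, (k < size s)%N ->
             nth 0 (0 :: s) k.+1 - nth 0 (0 :: s) k < delta].

Definition vanishing_mesh t : set_system (seq R) :=
  filter_from [set delta | 0 < delta] (fine_partition t).

Definition young_integral v x t : 'cV[R]_e :=
  lim (young_sum v x s @[s --> vanishing_mesh t]).

End young.

#[global] Instance vanishing_mesh_filter (R : realType) (t : R) :
  Filter (vanishing_mesh t).
Proof.
apply: filter_from_filter; first by exists 1 => /=.
move=> i j /= i0 j0; exists (Num.min i j); first by rewrite /= lt_min i0.
move=> s [ps fs]; split; split=> // k ks; have := fs k ks;
  by rewrite lt_min => /andP[].
Qed.

Lemma vanishing_mesh_proper (R : realType) (t : R) :
  0 <= t -> ProperFilter (vanishing_mesh t).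
Proof.
move=> t0; apply: filter_from_proper => delta /= delta0.
have [->|tn0] := eqVneq t 0; first by exists [::]; split=> //; split.
have {tn0}t0 : 0 < t by rewrite lt_def tn0.
pose n := (Num.truncn (t / delta)).+1.
have n0 : 0 < n%:R :> R by rewrite ltr0n.
have tn : t / n%:R < delta.
  by rewrite ltr_pdivrMr// mulrC -ltr_pdivrMr// truncnS_gt.
pose s := mkseq (fun k => t / n%:R * k.+1%:R) n.
have sz : size s = n by rewrite size_mkseq.
have nths k : (k <= n)%N -> nth 0 (0 :: s) k = t / n%:R * k%:R.
  by case: k => [|k] kn; rewrite /= ?mulr0// nth_mkseq.
have step k : (k < n)%N ->
    nth 0 (0 :: s) k.+1 - nth 0 (0 :: s) k = t / n%:R.
  by move=> kn; rewrite !nths// 1?ltnW// -mulrBr -natrB// subSnn mulr1.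
exists s; split; last by move=> k; rewrite sz => /step ->.
split.
  apply/(pathP 0) => k; rewrite sz => kn.
  by rewrite -subr_gt0 [X in 0 < X]step// divr_gt0.
have -> : last 0 s = nth 0 (0 :: s) (size s) by rewrite (last_nth 0).
by rewrite sz nths// divfK// gt_eqF.
Qed.

(* Main.v *)
Require Import Defs.
From HB Require Import structures.
From mathcomp Require Import all_boot all_order all_algebra.
From mathcomp Require Import all_classical all_reals all_analysis.
From mathcomp Require Import ring lra.

Import Order.TTheory GRing.Theory Num.Theory.
Import numFieldNormedType.Exports.

Local Open Scope classical_set_scope.
Local Open Scope ring_scope.

Set Implicit Arguments.
Unset Strict Implicit.
Unset Printing Implicit Defensive.

(** Write th = a + 1/p > 1 and consider the germ Xi s t = v s (x t - x s), whose
    sums over subdivisions are the Riemann sums of the Young integral.  Its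
    defect Xi s t - Xi s u - Xi u t is (v s - v u) (x t - x u).  The p-variation
    of v is recorded by a control w, a superadditive function of intervals with
    |v t - v s| ^ p <= w s t, so the defect is at most a constant times
    w s t ^ (1/p) (t - s) ^ a, a quantity of total degree th > 1.

    Existence and Hoelder regularity.  Splitting a subdivision where the control
    is roughly halved shows that every Riemann sum over [s, t] is within
    C w s t ^ (1/p) (t - s) ^ a of Xi s t ([discrete_sewing],
    [young_germ_local]).  Applied on each block of a coarse subdivision, this
    compares it with any refinement; the total error over a subdivision of mesh
    h is O(h ^ (th - 1)), so the Riemann sums are Cauchy, and the integral I
    satisfies |I t - I s - Xi s t| <= C w s t ^ (1/p) (t - s) ^ a
    ([young_increment], [young_holder]).

    Continuity.  Let u be close to v through the time change lam, and put
    f = v - u.  The integral is linear in the integrand, so I v - I u = I f.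
    - The p-variation is invariant under time changes, so that of f is bounded
      by a number depending on v only; hence the a-Hoelder constant of I f is
      bounded uniformly in u.
    - On a fixed subdivision of small mesh, I f is uniformly close to a Riemann
      sum, which involves only finitely many values f r.  Each of them is the
      sum of v r - v (mu r) and v (mu r) - u r, where mu inverts lam.  The
      second is small because the distance is, and the first because mu r is
      close to r, provided v oscillates little around r.  Such points r are
      dense: halving an interval repeatedly, and keeping the half with the
      smaller control, makes the oscillation of v as small as wanted
      ([small_oscillation_dense]).  So I f is uniformly small
      ([young_integral_small]).
    - A family bounded in the a-Hoelder norm that is uniformly small is small in
      the b-Hoelder norm for b < a: use the Hoelder bound for |t - s| <= h and
      the uniform bound for |t - s| > h. *)

(** * Sums of a germ along a subdivision *)

Section germ_sums.
Context {R : realType}.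
Implicit Types (r s t u : R) (l : seq R).

Fixpoint germ_sum {V : zmodType} (Xi : R -> R -> V) s l : V :=
  if l is t :: l' then Xi s t + germ_sum Xi t l' else 0.

Lemma germ_sum_cat {V : zmodType} (Xi : R -> R -> V) s l1 l2 :
  germ_sum Xi s (l1 ++ l2) = germ_sum Xi s l1 + germ_sum Xi (last s l1) l2.
Proof.
by elim: l1 s => [|t l1 IH] s /=; rewrite ?add0r// IH addrA.
Qed.

Lemma path_last_le (e : rel R) s l :
  subrel e <%R -> path e s l -> s <= last s l.
Proof.
move=> e_lt; elim: l s => //= t l IH s /andP[/e_lt/ltW st /IH].
exact: le_trans.
Qed.

Lemma path_mem_le_last (e : rel R) s l t :
  subrel e <%R -> path e s l -> t \in l -> s < t <= last s l.
Proof.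
move=> e_lt; elim: l s => //= u l IH s /andP[/e_lt su ul].
rewrite inE => /orP[/eqP ->|tl]; first by rewrite su (path_last_le e_lt ul).
by have /andP[ut ->] := IH u ul tl; rewrite (lt_trans su ut).
Qed.

End germ_sums.

(** * The discrete sewing estimate *)

Section discrete_sewing.
Context {R : realType} {V : normedZmodType R}.
Variables (A B K th : R) (om : R -> R -> R) (Xi : R -> R -> V).
Hypothesis th_gt1 : 1 < th.
Hypothesis om_super :
  forall s u t, A <= s -> s <= u -> u <= t -> t <= B ->
    om s u + om u t <= om s t.
Hypothesis om_ge0 : forall s t, A <= s -> s <= t -> t <= B -> 0 <= om s t.
Hypothesis K_ge0 : 0 <= K.
Hypothesis Xixx : forall t, Xi t t = 0.
Hypothesis Xi_defect :
  forall s u t, A <= s -> s <= u -> u <= t -> t <= B ->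
    `|Xi s t - Xi s u - Xi u t| <= K * om s t `^ th.

(** The solution C of the recursion C = 2 + 2 C 2^-th met in the proof of
    [discrete_sewing]; it is positive because th > 1. *)
Definition sewing_const := 2 / (1 - 2 `^ (1 - th)).

Lemma sewing_const_gt0 : 0 < sewing_const.
Proof.
rewrite divr_gt0// subr_gt0 -opprB powRN invf_lt1 ?powR_gt0//.
have {1}<- : 1 `^ (th - 1) = 1 :> R by rewrite powR1.
by apply: gt0_ltr_powR; rewrite ?subr_gt0// ?nnegrE// ltr1n.
Qed.

Lemma sewing_const_fix :
  2 + 2 * (sewing_const * 2^-1 `^ th) = sewing_const.
Proof.
have := sewing_const_gt0; rewrite /sewing_const pmulr_rgt0// invr_gt0 => c0.
have -> : 2^-1 `^ th = 2^-1 * 2 `^ (1 - th).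
  rewrite powRD; last by rewrite pnatr_eq0 implybT.
  by rewrite powRr1// mulKf ?pnatr_eq0// -powR_inv1// -powRrM mulN1r.
by field; rewrite gt_eqF.
Qed.

Lemma om_monol s u t : A <= s -> s <= u -> u <= t -> t <= B -> om u t <= om s t.
Proof.
move=> As su ut tB; apply: le_trans (om_super As su ut tB).
by rewrite lerDr om_ge0// (le_trans ut).
Qed.

Lemma om_xx t : A <= t <= B -> om t t = 0.
Proof.
move=> /andP[At tB]; apply/eqP; rewrite eq_le om_ge0// andbT.
by have := om_super At (lexx t) (lexx t) tB; rewrite gerDl.
Qed.

(** Induction on the number of points.  Cut the subdivision of [s, b] at
    consecutive points y <= u such that the control of [s, y] and that of [u, b]
    are both at most half of that of [s, b].  The two outer pieces
    contribute C (om / 2) ^ th each by induction, and replacing the three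
    pieces by [s, b] costs two defects, so that C = 2 + 2 C 2^-th suffices. *)
Lemma discrete_sewing s l : A <= s -> path <%R s l -> last s l <= B ->
  `|germ_sum Xi s l - Xi s (last s l)|
     <= sewing_const * K * om s (last s l) `^ th.
Proof.
have C0 := ltW sewing_const_gt0.
have [n] := ubnP (size l); elim: n => // n IH in s l *.
case: (l =P [::]) => [-> _ As _ _|/eqP lN].
  by rewrite /= Xixx subrr normr0 mulr_ge0 ?powR_ge0 ?(mulr_ge0 C0).
rewrite ltnS => ln As pl lB.
have sl := path_last_le (fun _ _ => id) pl.
have omsl := om_ge0 As sl lB.
have memlast (s' : R) l' : l' != [::] -> last s' l' \in l'.
  by case: l' => //= x l' _; rewrite mem_last.
(* u is the first point at which more than half of the control is spent, or
   the last point when there is none. *)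
pose P u := (u == last s l) || (om s (last s l) < 2 * om s u).
have [u [l1 [l2 [Dl Pu nP]]]] :
    exists u l1 l2, [/\ l = l1 ++ u :: l2, P u & ~~ has P l1].
  have : has P l by apply/hasP; exists (last s l); rewrite ?memlast// /P eqxx.
  by case/split_find => u l1 l2 Pu nP; exists u, l1, l2; rewrite cat_rcons.
move: Pu nP pl ln sl omsl lB; rewrite {}/P Dl last_cat /= => {lN}.
set b := last u l2; set y := last s l1 => Pu nP.
rewrite cat_path => /andP[pl1 /andP[yu pl2]].
rewrite size_cat /= addnS => ln sb omsl bB.
have sy : s <= y := path_last_le (fun _ _ => id) pl1.
have ub : u <= b := path_last_le (fun _ _ => id) pl2.
have {}yu : y <= u := ltW yu.
have Ay := le_trans As sy; have Au := le_trans Ay yu.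
have yb := le_trans yu ub.
have ysmall : om s y <= 2^-1 * om s b.
  have [l1E|l1N] := eqVneq l1 [::].
    by rewrite /y l1E om_xx ?As ?(le_trans sb)// mulr_ge0.
  have /hasPn/(_ y (memlast s l1 l1N)) := nP;
    rewrite negb_or -leNgt => /andP[_].
  by lra.
have usmall : om u b <= 2^-1 * om s b.
  case/orP: Pu => [/eqP ubE|ubig].
    by rewrite ubE om_xx ?mulr_ge0// bB -ubE Au.
  have := om_super As (le_trans sy yu) ub bB; lra.
have half w : 0 <= w -> w <= 2^-1 * om s b ->
    w `^ th <= 2^-1 `^ th * om s b `^ th.
  move=> w0 ws; rewrite -powRM//; apply: ge0_ler_powR => //;
    rewrite ?nnegrE ?mulr_ge0//.
  by rewrite ltW// (lt_trans _ th_gt1).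
have E1 := IH s l1 (leq_ltn_trans (leq_addr _ _) ln) As pl1 (le_trans yb bB).
have E2 := IH u l2 (leq_ltn_trans (leq_addl _ _) ln) Au pl2 bB.
have D1 := Xi_defect As sy yb bB.
have D2 := Xi_defect Ay yu ub bB.
have om_yb : om y b `^ th <= om s b `^ th.
  apply: ge0_ler_powR; rewrite ?nnegrE ?om_ge0// ?om_monol//.
  by rewrite ltW// (lt_trans _ th_gt1).
rewrite germ_sum_cat /= -/y -/b in E1 E2 *.
have -> : germ_sum Xi s l1 + (Xi y u + germ_sum Xi u l2) - Xi s b =
    (germ_sum Xi s l1 - Xi s y) + (germ_sum Xi u l2 - Xi u b)
    - (Xi s b - Xi s y - Xi y b) - (Xi y b - Xi y u - Xi u b).
  by rewrite !opprB [RHS](AC ((2*2)*(1*2)*(1*2))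
                             (1*(9*3)*7*(6*2)*(5*10)*(8*4)))/= !subrr !addr0.
have := half _ (om_ge0 As sy (le_trans yb bB)) ysmall.
have := half _ (om_ge0 Au ub bB) usmall.
have := sewing_const_fix.
set X := om s b `^ th in om_yb D1 *; set C := sewing_const in E1 E2 C0 * =>
  CE H2 H1.
rewrite (le_trans (ler_normB _ _))//.
have := ler_normB (germ_sum Xi s l1 - Xi s y + (germ_sum Xi u l2 - Xi u b))
  (Xi s b - Xi s y - Xi y b).
have := ler_normD (germ_sum Xi s l1 - Xi s y) (germ_sum Xi u l2 - Xi u b).
have CK0 : 0 <= C * K by rewrite mulr_ge0.
have := ler_wpM2l CK0 H1; have := ler_wpM2l CK0 H2;
  have := ler_wpM2l K_ge0 om_yb.
have : C * K * X = K * X * (2 + 2 * (C * 2^-1 `^ th)) by rewrite CE; ring.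
lra.
Qed.
End discrete_sewing.

(** * Subdivisions and refinements *)

Section refinement.
Context {R : realType}.
Implicit Types (s t : R) (l m : seq R).

Definition step_lt (delta : R) : rel R := fun u v => (u < v) && (v - u < delta).

Lemma step_lt_lt delta : subrel (step_lt delta) <%R.
Proof. by move=> u v /andP[]. Qed.

Lemma fine_partitionP t delta l :
  fine_partition t delta l <-> path (step_lt delta) 0 l /\ last 0 l = t.
Proof.
split=> [[[/(pathP 0) pl /eqP ll] dl]|[/(pathP 0) pl ll]].
  by split=> //; apply/(pathP 0) => i il; rewrite /step_lt pl//=; exact: dl.
split; first split; last 2 first.
- by rewrite ll.
- by move=> i il; have /andP[] := pl i il.
by apply/(pathP 0) => i il; have /andP[] := pl i il.
Qed.

Lemma common_refinement t l1 l2 :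
  path <%R 0 l1 -> last 0 l1 = t -> path <%R 0 l2 -> last 0 l2 = t ->
  exists m, [/\ path <%R 0 m, last 0 m = t,
    {subset l1 <= m} & {subset l2 <= m}].
Proof.
move=> p1 e1 p2 e2; pose m := sort <=%O (undup (l1 ++ l2)).
have memm u : (u \in m) = (u \in l1) || (u \in l2).
  by rewrite mem_sort mem_undup mem_cat.
have pm : path <%R 0 m.
  rewrite lt_path_sortedE sort_lt_sorted undup_uniq andbT.
  apply/allP => u; rewrite memm => /orP[] ul.
    by have /andP[] := path_mem_le_last (fun _ _ => id) p1 ul.
  by have /andP[] := path_mem_le_last (fun _ _ => id) p2 ul.
exists m; split=> //; last 2 first.
- by move=> u; rewrite memm => ->.
- by move=> u; rewrite memm => ->; rewrite orbT.
have le_t u : u \in m -> u <= t.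
  rewrite memm => /orP[] ul.
    by have /andP[_] := path_mem_le_last (fun _ _ => id) p1 ul; rewrite e1.
  by have /andP[_] := path_mem_le_last (fun _ _ => id) p2 ul; rewrite e2.
have le_last u : u \in 0 :: m -> u <= last 0 m.
  rewrite inE => /orP[/eqP ->|um]; first exact: path_last_le pm.
  by have /andP[] := path_mem_le_last (fun _ _ => id) pm um.
apply/eqP; rewrite eq_le le_last.
  have := mem_last 0 m; rewrite inE => /orP[/eqP ->|/le_t ->//].
  by rewrite -e1 (path_last_le (fun _ _ => id) p1).
by have := mem_last 0 l1; rewrite e1 !inE memm => /orP[] ->; rewrite ?orbT.
Qed.

(** Each block of the coarse subdivision s :: l is itself subdivided by the
    finer one, so the estimates on the blocks add up to a sum of E. *)
Lemma germ_sum_refine {V : normedZmodType R} (A B : R) (Xi : R -> R -> V)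
    E s l m :
  (forall s l, A <= s -> path <%R s l -> last s l <= B ->
     `|germ_sum Xi s l - Xi s (last s l)| <= E s (last s l)) ->
  A <= s -> path <%R s l -> path <%R s m -> last s m = last s l ->
  last s l <= B -> {subset l <= m} ->
  `|germ_sum Xi s m - germ_sum Xi s l| <= germ_sum E s l.
Proof.
move=> HE; elim: l => [|t l IH] /= in s m *.
  move=> As _ pm em sB _; case: m pm em => [|u m /= /andP[su um] em].
    by rewrite subrr normr0.
  have := path_last_le (fun _ _ => id) um.
  by rewrite em leNgt su.
move=> As /andP[st tl] pm em lB sub.
have tm : t \in m by apply: sub; rewrite mem_head.
move: pm em sub; case/splitPr: tm => m1 m2; rewrite cat_path last_cat /=.
move=> /andP[pm1 /andP[m1t pm2]] em sub.
rewrite germ_sum_cat /=.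
have tB : t <= B by apply: le_trans lB; exact: path_last_le tl.
have sub2 : {subset l <= m2}.
  move=> u ul; have /andP[tu _] := path_mem_le_last (fun _ _ => id) tl ul.
  have := sub u; rewrite inE ul orbT mem_cat inE => /(_ isT).
  rewrite (gt_eqF tu)/= => /orP[um1|//].
  have /andP[_] := path_mem_le_last (fun _ _ => id) pm1 um1.
  by move=> /le_lt_trans/(_ m1t)/(lt_trans tu); rewrite ltxx.
have := IH t m2 (le_trans As (ltW st)) tl pm2 em lB sub2.
have := HE s (rcons m1 t); rewrite rcons_path last_rcons pm1 m1t =>
  /(_ As isT tB).
rewrite -cats1 germ_sum_cat /= addr0 => H1 H2.
rewrite (le_trans _ (lerD H1 H2))// (le_trans _ (ler_normD _ _))//.
by rewrite le_eqVlt (AC (3*2) ((1*2*4)*(3*5)))/= opprD !addrA eqxx.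
Qed.

(** Cuts a fixed subdivision at an arbitrary time t without enlarging the set of
    its left endpoints, which are the only points where the integrand of a
    Riemann sum is evaluated. *)
Lemma truncated_partition {U : normedZmodType R} (e : rel R) (Xi : R -> R -> U)
    c t s l :
  subrel e <%R -> (forall r u u', e r u -> r < u' -> u' <= u -> e r u') ->
  0 <= c -> path e s l -> s < t -> t <= last s l ->
  (forall r u, r \in s :: l -> r < u -> u <= last s l -> `|Xi r u| <= c) ->
  exists l', [/\ path e s l', last s l' = t &
    `|germ_sum Xi s l'| <= (size l)%:R * c].
Proof.
move=> e_lt e_trunc c0; elim: l s => [|u l IH] s /=.
  by move=> _ st /(lt_le_trans st); rewrite ltxx.
move=> /andP[su ul] st tl Hc.
have [tu|ut] := leP t u.
  exists [:: t]; split=> //=; first by rewrite andbT (e_trunc _ _ _ su).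
  rewrite addr0 (le_trans (Hc _ _ (mem_head _ _) st tl))//.
  by rewrite mulrSr mulrDl mul1r lerDr mulr_ge0.
have [l' [pl' el' Hl']] := IH u ul ut tl
  (fun r v rl => Hc r v (mem_behead (s := s :: u :: l) rl)).
exists (u :: l'); split=> //=; first by rewrite su.
rewrite (le_trans (ler_normD _ _))// mulrSr mulrDl mul1r addrC lerD//.
by rewrite Hc ?mem_head ?e_lt// (path_last_le e_lt ul).
Qed.

End refinement.

(** * The sewing lemma *)

Lemma powR_small (R : realType) (K W g eps : R) : 0 <= K -> 0 <= W -> 0 < g ->
  0 < eps -> exists2 h, 0 < h & K * h `^ g * W <= eps.
Proof.
move=> K0 W0 g0 e0; have c0 : 0 < K * W + 1 by rewrite ltr_wpDl// mulr_ge0.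
have ec : 0 < eps / (K * W + 1) by rewrite divr_gt0.
exists ((eps / (K * W + 1)) `^ g^-1); first exact: powR_gt0.
rewrite -powRrM mulVf ?gt_eqF// powRr1 ?(ltW ec)//.
rewrite mulrAC mulrA ler_pdivrMr// mulrC ler_wpM2l ?(ltW e0)//.
by rewrite lerDl.
Qed.

Section sewing.
Context {R : realType} {V : completeNormedModType R}.
Variables (T K g : R) (w E : R -> R -> R) (Xi : R -> R -> V).
Hypothesis K_ge0 : 0 <= K.
Hypothesis g_gt0 : 0 < g.
Hypothesis w_super :
  forall s u t, 0 <= s -> s <= u -> u <= t -> t <= T -> w s u + w u t <= w s t.
Hypothesis w_ge0 : forall s t, 0 <= s -> s <= t -> t <= T -> 0 <= w s t.
Hypothesis E_le : forall s t, 0 <= s -> s < t -> t <= T ->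
  E s t <= K * (t - s) `^ g * w s t.
Hypothesis Xi_local : forall s l, 0 <= s -> path <%R s l -> last s l <= T ->
  `|germ_sum Xi s l - Xi s (last s l)| <= E s (last s l).

(** One factor (t - s) ^ g of the error is bounded by the mesh; the rest is
    summable because w is superadditive. *)
Lemma germ_sum_mesh delta s l : 0 <= delta -> 0 <= s ->
  path (step_lt delta) s l -> last s l <= T ->
  germ_sum E s l <= K * delta `^ g * w s (last s l).
Proof.
move=> d0; elim: l s => [|t l IH] s s0 /=.
  by move=> _ sT; rewrite !mulr_ge0 ?powR_ge0 ?w_ge0.
move=> /andP[/andP[st tsd] tl] lT.
have t0 := le_trans s0 (ltW st).
have tlast := path_last_le (@step_lt_lt R delta) tl.
apply: le_trans (lerD (E_le s0 st (le_trans tlast lT)) (IH t t0 tl lT)) _.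
have Kd : 0 <= K * delta `^ g by rewrite mulr_ge0 ?powR_ge0.
apply: le_trans (ler_wpM2l Kd (w_super s0 (ltW st) tlast lT)).
rewrite mulrDr lerD2r ler_wpM2r ?w_ge0 ?(ltW st) ?(le_trans tlast)//.
rewrite ler_wpM2l//; apply: ge0_ler_powR; rewrite ?nnegrE ?subr_ge0 ?(ltW st)//.
  exact: ltW.
exact: ltW.
Qed.

Lemma germ_sum_mesh0 delta l : 0 <= delta ->
  path (step_lt delta) 0 l -> last 0 l <= T ->
  germ_sum E 0 l <= K * delta `^ g * w 0 T.
Proof.
move=> d0 pl lT; have l0 := path_last_le (@step_lt_lt R delta) pl.
apply: le_trans (germ_sum_mesh d0 (lexx 0) pl lT) _.
rewrite ler_wpM2l ?mulr_ge0 ?powR_ge0//.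
apply: le_trans (w_super (lexx 0) l0 lT (lexx T)).
by rewrite lerDl w_ge0.
Qed.

Lemma germ_sum_fine eps : 0 < eps -> exists2 delta, 0 < delta &
  forall l, path (step_lt delta) 0 l -> last 0 l <= T -> germ_sum E 0 l <= eps.
Proof.
move=> e0.
have [T0|T0] := ltP T 0.
  exists 1 => // l pl lT; have := path_last_le (@step_lt_lt R 1) pl.
  by move=> /le_trans/(_ lT); rewrite leNgt T0.
have [h h0 Hh] := powR_small K_ge0 (w_ge0 (lexx 0) T0 (lexx T)) g_gt0 e0.
by exists h => // l pl lT; apply: le_trans (germ_sum_mesh0 (ltW h0) pl lT) Hh.
Qed.

(** Both sums are compared with the one over a common refinement. *)
Lemma germ_sum_comparison t l m :
  t <= T -> path <%R 0 l -> last 0 l = t -> path <%R 0 m -> last 0 m = t ->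
  `|germ_sum Xi 0 l - germ_sum Xi 0 m| <= germ_sum E 0 l + germ_sum E 0 m.
Proof.
move=> tT pl el pm em.
have [r [pr er lr mr]] := common_refinement pl el pm em.
have Hl : `|germ_sum Xi 0 r - germ_sum Xi 0 l| <= germ_sum E 0 l.
  by apply: (germ_sum_refine Xi_local) => //; rewrite ?er ?el.
have Hm : `|germ_sum Xi 0 r - germ_sum Xi 0 m| <= germ_sum E 0 m.
  by apply: (germ_sum_refine Xi_local) => //; rewrite ?er ?em.
rewrite (le_trans (ler_distD (germ_sum Xi 0 r) _ _))//.
by rewrite [X in X + _]distrC lerD.
Qed.

Definition sewn t : V := lim (germ_sum Xi 0 l @[l --> vanishing_mesh t]).

Lemma sewing_cvg t : 0 <= t <= T ->
  cvg (germ_sum Xi 0 l @[l --> vanishing_mesh t]).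
Proof.
move=> /andP[t0 tT]; have PF := vanishing_mesh_proper t0.
apply/cauchy_cvgP; apply: cauchy_exP => eps e0.
have e40 : 0 < eps / 4 by rewrite divr_gt0.
have [delta d0 Hd] := germ_sum_fine e40.
have Ud : vanishing_mesh t (fine_partition t delta) by exists delta.
have [l /fine_partitionP[pl el]] := filter_ex Ud.
exists (germ_sum Xi 0 l); exists delta => //= m /fine_partitionP[pm em].
rewrite -ball_normE /=.
have := germ_sum_comparison tT (sub_path (@step_lt_lt R delta) pl) el
  (sub_path (@step_lt_lt R delta) pm) em.
have := Hd l pl; have := Hd m pm; rewrite el em => /(_ tT) H1 /(_ tT) H2 H3.
lra.
Qed.

(** Unlike convergence along vanishing meshes, this bounds the error for any
    given subdivision; it follows by comparison with arbitrarily fine ones. *)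
Lemma sewing_approx t l : 0 <= t <= T -> path <%R 0 l -> last 0 l = t ->
  `|sewn t - germ_sum Xi 0 l| <= germ_sum E 0 l.
Proof.
move=> tT pl el; have /andP[t0 t1] := tT.
have PF := vanishing_mesh_proper t0.
apply/ler_addgt0Pr => eps e0.
have e20 : 0 < eps / 2 by rewrite divr_gt0.
have [delta d0 Hd] := germ_sum_fine e20.
have Ud : vanishing_mesh t (fine_partition t delta) by exists delta.
have /cvgrPdist_le/(_ _ e20) Hlim := sewing_cvg tT.
have [m [/fine_partitionP[pm em] Hm]] := filter_ex (filterI Ud Hlim).
have pm' := sub_path (@step_lt_lt R delta) pm.
have := germ_sum_comparison t1 pm' em pl el.
have := Hd m pm; rewrite em => /(_ t1).
have := ler_distD (germ_sum Xi 0 m) (sewn t) (germ_sum Xi 0 l).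
move: Hm; rewrite /sewn /=; lra.
Qed.

(** A fine subdivision of [0, s] followed by the single block [s, t] is compared
    with the integrals up to s and up to t. *)
Lemma sewing_increment s t : 0 <= s -> s < t -> t <= T ->
  `|sewn t - sewn s - Xi s t| <= E s t.
Proof.
move=> s0 st tT; have sT := le_trans (ltW st) tT.
have PF := vanishing_mesh_proper s0.
apply/ler_addgt0Pr => eps e0.
have e20 : 0 < eps / 2 by rewrite divr_gt0.
have [delta d0 Hd] := germ_sum_fine e20.
have Ud : vanishing_mesh s (fine_partition s delta) by exists delta.
have [l /fine_partitionP[pl el]] := filter_ex Ud.
have pl' := sub_path (@step_lt_lt R delta) pl.
have Hl := Hd l pl; rewrite el in Hl; have {}Hl := Hl sT.
have := sewing_approx (t := s) _ pl' el; rewrite s0 sT => /(_ isT) As.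
have := sewing_approx (t := t) (l := rcons l t).
rewrite (le_trans s0 (ltW st)) tT rcons_path last_rcons el pl' st.
rewrite -cats1 !germ_sum_cat /= el !addr0 => /(_ isT isT erefl) At.
have -> : sewn t - sewn s - Xi s t =
    (sewn t - (germ_sum Xi 0 l + Xi s t)) - (sewn s - germ_sum Xi 0 l).
  by rewrite opprB opprD [RHS](AC (1*2*2) ((1*5*3)*(2*4)))/= addNr addr0.
rewrite (le_trans (ler_normB _ _))//; lra.
Qed.

End sewing.

(** * Controls of the p-variation *)

Section variation.
Context {R : realType} {V : normedModType R}.
Implicit Types (T p W s t u : R) (f : R -> V) (l : seq R).

Lemma germ_sum_nth {U : zmodType} (Xi : R -> R -> U) s l :
  germ_sum Xi s l =
  \sum_(0 <= k < size l) Xi (nth 0 (s :: l) k) (nth 0 (s :: l) k.+1).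
Proof.
elim: l s => [|t l IH] s /=; first by rewrite big_geq.
by rewrite big_nat_recl//= IH.
Qed.

Definition jump_pow p f s t : R := `|f t - f s| `^ p.

(** The p-th power of the p-variation on [0, T] is at most W. *)
Definition pvar_le T p f W := forall s l, 0 <= s -> path <%R s l ->
  last s l <= T -> germ_sum (jump_pow p f) s l <= W.

Lemma germ_sum_jump_ge0 p f s l : 0 <= germ_sum (jump_pow p f) s l.
Proof. by elim: l s => //= t l IH s; rewrite addr_ge0// powR_ge0. Qed.

Lemma pvar_le_ge0 T p f W : 0 <= T -> pvar_le T p f W -> 0 <= W.
Proof. by move=> T0 /(_ 0 [::]); apply. Qed.

Lemma p_variation_le T p f c : 1 <= p ->
  (p_variation T p f <= c%:E)%E -> pvar_le T p f (c `^ p).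
Proof.
move=> p1 Vc s l s0 pl lT; have p0 := lt_le_trans ltr01 p1.
set S := germ_sum _ _ _; have S0 : 0 <= S := germ_sum_jump_ge0 _ _ _ _.
have : ((S `^ p^-1)%:E <= c%:E)%E.
  apply: le_trans Vc; apply: ereal_sup_ubound.
  exists (size l), (nth 0 (s :: l)); split.
  - move=> k kl; rewrite in_itv /=.
    have : nth 0 (s :: l) k \in s :: l by rewrite mem_nth.
    rewrite inE => /orP[/eqP ->|kin].
      by rewrite s0 (le_trans (path_last_le (fun _ _ => id) pl)).
    have /andP[/ltW sk kl'] := path_mem_le_last (fun _ _ => id) pl kin.
    by rewrite (le_trans s0 sk) (le_trans kl').
  - by move=> k kl; have /(pathP 0)/(_ k kl) := pl.
  - by rewrite /S germ_sum_nth.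
rewrite lee_fin => Sc.
have : (S `^ p^-1) `^ p <= c `^ p.
  apply: ge0_ler_powR => //; rewrite ?nnegrE ?powR_ge0// ?(ltW p0)//.
  exact: le_trans (powR_ge0 _ _) Sc.
by rewrite -powRrM mulVf ?gt_eqF// powRr1.
Qed.

Lemma p_variation_fin T p f : 1 <= p -> (p_variation T p f < +oo)%E ->
  exists W, pvar_le T p f W.
Proof.
move=> p1 fin.
suff [c Hc] : exists c : R, (p_variation T p f <= c%:E)%E.
  by exists (c `^ p); exact: p_variation_le.
case: (p_variation T p f) fin => [r _|//|_]; first by exists r.
by exists 0; rewrite leNye.
Qed.

(** The second condition makes a control positive on nondegenerate intervals
    and lets it dominate their length, so that a power of t - s with exponent
    1 - 1/p can be traded for the same power of w s t. *)
Definition is_control T p f (w : R -> R -> R) :=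
  [/\ forall s u t, 0 <= s -> s <= u -> u <= t -> t <= T ->
        w s u + w u t <= w s t,
      forall s t, 0 <= s -> s <= t -> t <= T -> t - s <= w s t &
      forall s t, 0 <= s -> s <= t -> t <= T -> `|f t - f s| `^ p <= w s t].

(** The supremum of the p-variation sums over subdivisions inside [s, t],
    increased by t - s: concatenating subdivisions gives superadditivity. *)
Lemma exists_control T p f W : 1 <= p -> 0 <= T -> pvar_le T p f W ->
  exists2 w, is_control T p f w & w 0 T <= W + T.
Proof.
move=> p1 T0 HW; have p0 := lt_le_trans ltr01 p1.
pose D s t := [set r | exists u l,
  [/\ s <= u, path <%R u l, last u l <= t & r = germ_sum (jump_pow p f) u l]].
have DW s t : 0 <= s -> t <= T -> ubound (D s t) W.
  move=> s0 tT _ [u [l [su ul lt ->]]]; apply: HW => //.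
    exact: le_trans su.
  exact: le_trans tT.
have Dle s t r : 0 <= s -> t <= T -> D s t r -> r <= sup (D s t).
  by move=> s0 tT; apply: ub_le_sup; exists W; exact: DW.
have D0 s t : s <= t -> D s t 0 by move=> st; exists s, [::]; split.
exists (fun s t => sup (D s t) + (t - s)); last first.
  by rewrite subr0 lerD2r; apply: ge_sup; [exists 0; exact: D0|exact: DW].
split.
- move=> s u t s0 su ut tT.
  suff : sup (D s u) + sup (D u t) <= sup (D s t) by lra.
  rewrite -lerBrDr; apply: ge_sup; first by exists 0; exact: D0.
  move=> r1 Dr1; rewrite lerBrDr addrC -lerBrDr.
  apply: ge_sup; first by exists 0; exact: D0.
  move=> r2 Dr2; rewrite lerBrDr addrC.
  move: Dr1 Dr2 => [y [l [sy yl lu ->]]] [z [m [uz zm mt ->]]].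
  have [lz|lz] := eqVneq (last y l) z.
    apply: Dle => //; exists y, (l ++ m); split=> //.
    + by rewrite cat_path yl lz.
    + by rewrite last_cat lz.
    + by rewrite germ_sum_cat lz.
  have lz' : last y l < z by rewrite lt_neqAle lz (le_trans lu).
  apply: (@le_trans _ _ (germ_sum (jump_pow p f) y (l ++ z :: m))).
    by rewrite germ_sum_cat /= lerD2l lerDr powR_ge0.
  apply: Dle => //; exists y, (l ++ z :: m); split=> //.
  + by rewrite cat_path yl /= lz'.
  + by rewrite last_cat.
- by move=> s t s0 st tT; rewrite lerDr; apply: Dle => //; exact: D0.
- move=> s t s0 st tT.
  have Hs : `|f t - f s| `^ p <= sup (D s t); last by lra.
  have [stE|sNt] := eqVneq s t.
    rewrite -stE subrr normr0 powR0 ?gt_eqF//; apply: Dle => //.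
      exact: le_trans tT.
    exact: D0.
  apply: Dle => //; exists s, [:: t]; split=> //=; last by rewrite addr0.
  by rewrite lt_neqAle sNt st.
Qed.

Lemma control_ge0 T p f w s t : is_control T p f w ->
  0 <= s -> s <= t -> t <= T -> 0 <= w s t.
Proof.
by move=> [_ Hw _] s0 st tT; apply: le_trans (Hw s t s0 st tT);
  rewrite subr_ge0.
Qed.

Lemma control_mono T p f w s s' t' t : is_control T p f w ->
  0 <= s -> s <= s' -> s' <= t' -> t' <= t -> t <= T -> w s' t' <= w s t.
Proof.
move=> wc s0 ss st tt tT; have [sup _ _] := wc.
have s'0 := le_trans s0 ss; have t'T := le_trans tt tT.
apply: le_trans (sup s t' t s0 (le_trans ss st) tt tT).
rewrite -[leLHS]addr0 lerD//; last first.
  by apply: (control_ge0 wc) => //; exact: le_trans st.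
apply: le_trans (sup s s' t' s0 ss st t'T).
by rewrite lerDr (control_ge0 wc)// (le_trans st).
Qed.

Lemma control_jump T p f w s t : 1 <= p -> is_control T p f w ->
  0 <= s -> s <= t -> t <= T -> `|f t - f s| <= w s t `^ p^-1.
Proof.
move=> p1 wc s0 st tT; have p0 := lt_le_trans ltr01 p1.
have [_ _ /(_ s t s0 st tT) Hw] := wc.
have : (`|f t - f s| `^ p) `^ p^-1 <= w s t `^ p^-1.
  apply: ge0_ler_powR; rewrite ?nnegrE ?powR_ge0// ?invr_ge0 ?(ltW p0)//.
  exact: control_ge0 wc _ _ _.
by rewrite -powRrM mulfV ?gt_eqF// powRr1.
Qed.

End variation.

(** * The Young integral *)

(** Matrices are both a complete uniform space and a normed module; this
    declares the join of the two structures. *)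
HB.instance Definition _ (R : realType) m n :=
  Complete.copy 'M[R]_(m, n) 'M[R]_(m, n).

Lemma mx_norm_mul_le (R : realType) m n q (A : 'M[R]_(m, n)) (B : 'M[R]_(n, q)) :
  `|A *m B| <= n%:R * `|A| * `|B|.
Proof.
have entry k l (M : 'M[R]_(k, l)) i j : `|M i j| <= `|M|.
  rewrite [leRHS]/Num.norm /= mx_normrE.
  exact: (le_bigmax _ (fun ij => `|M ij.1 ij.2|) (i, j)).
rewrite [leLHS]/Num.norm /= mx_normrE; apply/bigmax_leP; split.
  by rewrite !mulr_ge0.
move=> [i j] _ /=; rewrite mxE (le_trans (ler_norm_sum _ _ _))//.
apply: (@le_trans _ _ (\sum_(k < n) `|A| * `|B|)).
  by apply: ler_sum => k _; rewrite normrM ler_pM.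
by rewrite sumr_const card_ord -mulrA mulr_natl.
Qed.

Section young.
Context {R : realType} {d e : nat}.
Variables (T p a H : R) (x : R -> 'cV[R]_d).
Hypothesis p_ge1 : 1 <= p.
Hypothesis a_gt0 : 0 < a.
Hypothesis young_cond : 1 < a + p^-1.
Hypothesis H_ge0 : 0 <= H.
Hypothesis x_holder : forall s t : R, 0 <= s -> s <= t -> t <= T ->
  `|x t - x s| <= H * (t - s) `^ a.
Implicit Types (f : R -> 'M[R]_(e, d)) (w : R -> R -> R) (s t : R) (l : seq R).

Definition young_germ f s t : 'cV[R]_e := f s *m (x t - x s).

Lemma young_sumE f : young_sum f x = germ_sum (young_germ f) 0.
Proof. by apply/funext => l; rewrite germ_sum_nth. Qed.

Definition young_const : R :=
  sewing_const (a + p^-1) * (d%:R * H) * 2 `^ (a + p^-1).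

Definition young_error w s t : R :=
  young_const * (w s t `^ p^-1 * (t - s) `^ a).

Lemma young_const_ge0 : 0 <= young_const.
Proof.
apply: mulr_ge0; last exact: powR_ge0.
by apply: mulr_ge0; [exact/ltW/sewing_const_gt0|exact: mulr_ge0].
Qed.

Lemma young_germ_le f s t : 0 <= s -> s <= t -> t <= T ->
  `|young_germ f s t| <= d%:R * `|f s| * (H * (t - s) `^ a).
Proof.
move=> s0 st tT; rewrite (le_trans (mx_norm_mul_le _ _))//.
by rewrite ler_wpM2l ?mulr_ge0// x_holder.
Qed.

(** On a fixed interval [s, t], normalize the control and the length to total
    mass 1 each and add them: the defect is then bounded by
    d H w s t ^ (1/p) (t - s) ^ a times om ^ (a + 1/p), as [discrete_sewing]
    requires, with om s t = 2. *)
Lemma young_germ_local f w s l : is_control T p f w ->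
  0 <= s -> path <%R s l -> last s l <= T ->
  `|germ_sum (young_germ f) s l - young_germ f s (last s l)|
     <= young_error w s (last s l).
Proof.
move=> wc s0 pl; set t := last s l => tT; have p0 := lt_le_trans ltr01 p_ge1.
have st : s <= t := path_last_le (fun _ _ => id) pl.
have germxx u : young_germ f u u = 0 by rewrite /young_germ subrr mulmx0.
have [l0|l0] := eqVneq l [::].
  rewrite /t l0 /= germxx subr0 normr0 /young_error.
  by rewrite (mulr_ge0 young_const_ge0)// mulr_ge0 ?powR_ge0.
have {}st : s < t.
  rewrite lt_neqAle st andbT; apply/eqP => stE; move: pl l0.
  rewrite /t in stE; case: (l) stE => //= u m stE /andP[su um] _.
  by have := path_last_le (fun _ _ => id) um; rewrite -stE leNgt su.
have [wsup wlen _] := wc.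
have ts0 : 0 < t - s by rewrite subr_gt0.
have W0 : 0 < w s t := lt_le_trans ts0 (wlen s t s0 (ltW st) tT).
pose om u v := w u v / w s t + (v - u) / (t - s).
have om2 : om s t = 2 by rewrite /om !divff ?gt_eqF.
pose K := d%:R * H * (w s t `^ p^-1 * (t - s) `^ a).
have om_ge0 u v : s <= u -> u <= v -> v <= t -> 0 <= om u v.
  move=> su uv vt; rewrite addr_ge0// divr_ge0 ?(ltW W0) ?(ltW ts0) ?subr_ge0//.
  by apply: (control_ge0 wc) => //; [exact: le_trans su|exact: le_trans tT].
have := @discrete_sewing R _ s t K (a + p^-1) om (young_germ f) young_cond
  _ om_ge0 _ germxx _ s l (lexx s) pl (lexx t).
rewrite -/t om2 /young_error /young_const => Hs.
apply: le_trans (Hs _ _ _) _; last 1 first.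
- by rewrite /K le_eqVlt; apply/orP; left; apply/eqP; ring.
- move=> u v r su uv vr rt; rewrite /om.
  have : w u v / w s t + w v r / w s t <= w u r / w s t.
    rewrite -mulrDl ler_pM2r ?invr_gt0//; apply: wsup => //.
      exact: le_trans su.
    exact: le_trans tT.
  have : (v - u) / (t - s) + (r - v) / (t - s) = (r - u) / (t - s) by ring.
  by lra.
- by rewrite /K !mulr_ge0// powR_ge0.
move=> u v r su uv vr rt.
have u0 := le_trans s0 su; have v0 := le_trans u0 uv.
have rT := le_trans rt tT; have vT := le_trans vr rT.
have ur := le_trans uv vr.
have -> : young_germ f u r - young_germ f u v - young_germ f v r =
    (f u - f v) *m (x r - x v).
  rewrite /young_germ mulmxBl -mulmxBr; congr (f u *m _ - _).
  by rewrite opprB subrKA.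
apply: le_trans (mx_norm_mul_le _ _) _.
rewrite distrC.
have omr0 := om_ge0 u r su ur rt.
have mulKdiv (c y : R) : 0 < c -> c * (y / c) = y.
  by move=> c0; rewrite mulrC divfK ?gt_eqF.
have fb : `|f v - f u| <= w s t `^ p^-1 * om u r `^ p^-1.
  rewrite -powRM// ?(ltW W0)//;
  apply: le_trans (control_jump p_ge1 wc u0 uv vT) _.
  apply: ge0_ler_powR; rewrite ?nnegrE ?invr_ge0 ?(ltW p0)//
    ?mulr_ge0 ?(ltW W0)//.
    exact: control_ge0 wc _ _ _.
  rewrite /om mulrDr (mulKdiv _ _ W0).
  apply: (@le_trans _ _ (w u r)); first exact: control_mono wc _ _ _ _ _.
  by rewrite lerDl !mulr_ge0 ?invr_ge0 ?subr_ge0 ?(ltW W0)// (ltW st).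
have xb : `|x r - x v| <= H * ((t - s) `^ a * om u r `^ a).
  apply: le_trans (x_holder v0 vr rT) _; rewrite ler_wpM2l//.
  rewrite -powRM// ?(ltW ts0)//.
  apply: ge0_ler_powR; rewrite ?nnegrE ?(ltW a_gt0)// ?subr_ge0// ?mulr_ge0
    ?(ltW ts0)//.
  rewrite /om mulrDr (mulKdiv _ _ ts0).
  apply: (@le_trans _ _ (r - u)); first by rewrite lerD2l lerN2.
  by rewrite lerDr !mulr_ge0 ?invr_ge0 ?(ltW W0) ?(ltW ts0)// (control_ge0 wc).
have -> : K * om u r `^ (a + p^-1) = d%:R * (w s t `^ p^-1 * om u r `^ p^-1) *
    (H * ((t - s) `^ a * om u r `^ a)).
  rewrite powRD; first by rewrite /K; ring.
  by apply/implyP; rewrite gt_eqF// (lt_trans ltr01).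
by rewrite ler_pM// ?mulr_ge0// ler_wpM2l.
Qed.

(** Splits (t - s) ^ a into (t - s) ^ (a + 1/p - 1), which is left to the mesh,
    and (t - s) ^ (1 - 1/p), which is at most w s t ^ (1 - 1/p). *)
Lemma young_error_le f w s t : is_control T p f w ->
  0 <= s -> s < t -> t <= T ->
  young_error w s t <= young_const * (t - s) `^ (a + p^-1 - 1) * w s t.
Proof.
move=> wc s0 st tT; have p0 := lt_le_trans ltr01 p_ge1.
have [_ wlen _] := wc.
have ts0 : 0 < t - s by rewrite subr_gt0.
have W0 : 0 < w s t := lt_le_trans ts0 (wlen s t s0 (ltW st) tT).
rewrite -mulrA ler_wpM2l ?young_const_ge0//.
have -> : (t - s) `^ a = (t - s) `^ (a + p^-1 - 1) * (t - s) `^ (1 - p^-1).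
  by rewrite -powRD; [congr (_ `^ _); ring|rewrite (gt_eqF ts0) implybT].
rewrite mulrCA ler_wpM2l ?powR_ge0//.
rewrite -[leRHS]powRr1 ?(ltW W0)// -[X in _ <= _ `^ X](subrKC p^-1).
rewrite [leRHS]powRD ?(gt_eqF W0) ?implybT// ler_wpM2l ?powR_ge0//.
apply: ge0_ler_powR; rewrite ?nnegrE ?(ltW ts0) ?(ltW W0) ?subr_ge0 ?invf_le1//.
exact: wlen (ltW st) tT.
Qed.

Let g_gt0 : 0 < a + p^-1 - 1. Proof. by rewrite subr_gt0. Qed.

Lemma young_integralE f : young_integral f x = sewn (young_germ f).
Proof. by apply/funext => t; rewrite /young_integral young_sumE. Qed.

Lemma young_cvg f w t : is_control T p f w -> 0 <= t <= T ->
  cvg (young_sum f x s @[s --> vanishing_mesh t]).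
Proof.
move=> wc; rewrite young_sumE; have [wsup _ _] := wc.
apply: (sewing_cvg young_const_ge0 g_gt0 wsup).
- by move=> *; apply: (control_ge0 wc).
- by move=> s t' s0 st tT; exact: young_error_le wc s0 st tT.
- by move=> s l s0 pl lT; exact: young_germ_local wc s0 pl lT.
Qed.

Lemma young_mesh f w delta l : is_control T p f w -> 0 <= delta ->
  path (step_lt delta) 0 l -> last 0 l <= T ->
  germ_sum (young_error w) 0 l <= young_const * delta `^ (a + p^-1 - 1) * w 0 T.
Proof.
move=> wc; have [wsup _ _] := wc.
apply: (germ_sum_mesh0 young_const_ge0 g_gt0 wsup).
- by move=> *; apply: (control_ge0 wc).
- by move=> u v s0 st tT; exact: young_error_le wc s0 st tT.
Qed.

Lemma young_approx f w t l : is_control T p f w -> 0 <= t <= T ->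
  path <%R 0 l -> last 0 l = t ->
  `|young_integral f x t - germ_sum (young_germ f) 0 l| <=
    germ_sum (young_error w) 0 l.
Proof.
move=> wc; rewrite young_integralE; have [wsup _ _] := wc.
apply: (sewing_approx young_const_ge0 g_gt0 wsup).
- by move=> *; apply: (control_ge0 wc).
- by move=> s t' s0 st tT; exact: young_error_le wc s0 st tT.
- by move=> s m s0 pl lT; exact: young_germ_local wc s0 pl lT.
Qed.

Lemma young_increment f w s t : is_control T p f w ->
  0 <= s -> s < t -> t <= T ->
  `|young_integral f x t - young_integral f x s - young_germ f s t| <=
    young_error w s t.
Proof.
move=> wc; rewrite young_integralE; have [wsup _ _] := wc.
apply: (sewing_increment young_const_ge0 g_gt0 wsup).
- by move=> *; apply: (control_ge0 wc).
- by move=> u v s0 st tT; exact: young_error_le wc s0 st tT.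
- by move=> u m s0 pl lT; exact: young_germ_local wc s0 pl lT.
Qed.

Lemma young_holder f w M W s t : is_control T p f w -> w 0 T <= W ->
  `|f 0| <= M -> 0 <= s -> s < t -> t <= T ->
  `|young_integral f x t - young_integral f x s| <=
  (young_const * W `^ p^-1 + d%:R * (M + W `^ p^-1) * H) * (t - s) `^ a.
Proof.
move=> wc wW fM s0 st tT; have p0 := lt_le_trans ltr01 p_ge1.
have sT := le_trans (ltW st) tT.
have pw u v : 0 <= u -> u <= v -> v <= T -> w u v `^ p^-1 <= W `^ p^-1.
  move=> u0 uv vT; have wuv : w u v <= W.
    by apply: le_trans wW; exact: control_mono wc _ _ _ _ _.
  have := control_ge0 wc u0 uv vT => w0.
  apply: ge0_ler_powR; rewrite ?nnegrE ?invr_ge0 ?(ltW p0)//.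
  exact: le_trans wuv.
have fs : `|f s| <= M + W `^ p^-1.
  rewrite -[f s](subrKC (f 0)) (le_trans (ler_normD _ _))// lerD//.
  by apply: le_trans (pw 0 s (lexx 0) s0 sT); exact: control_jump wc _ _ _.
have := young_increment wc s0 st tT.
have := young_germ_le f s0 (ltW st) tT.
set I := young_integral f x t - young_integral f x s; set G := young_germ f s t.
have : `|I| <= `|I - G| + `|G| by rewrite -{1}(subrK G I) ler_normD.
have : young_error w s t <= young_const * W `^ p^-1 * (t - s) `^ a.
  rewrite -mulrA ler_wpM2l ?young_const_ge0// ler_wpM2r ?powR_ge0//.
  by rewrite pw// ltW.
have : d%:R * `|f s| * (H * (t - s) `^ a) <=
    d%:R * (M + W `^ p^-1) * H * (t - s) `^ a.
  by rewrite !mulrA ler_wpM2r ?powR_ge0// ler_wpM2r// ler_wpM2l.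
rewrite mulrDl; lra.
Qed.

End young.

(** * Variation under differences and time changes *)

Section variation_stability.
Context {R : realType} {V : normedModType R}.
Implicit Types (T p W s t u : R) (f : R -> V) (l : seq R) (w : R -> R -> R).

(** From |A - B| <= 2 max |A| |B| on each increment. *)
Lemma pvar_le_sub T p f1 f2 W1 W2 : 1 <= p ->
  pvar_le T p f1 W1 -> pvar_le T p f2 W2 ->
  pvar_le T p (fun t => f1 t - f2 t) (2 `^ p * (W1 + W2)).
Proof.
move=> p1 H1 H2 s l s0 pl lT; have p0 := lt_le_trans ltr01 p1.
have {H1}H1 := H1 s l s0 pl lT; have {H2}H2 := H2 s l s0 pl lT.
apply: (@le_trans _ _ (2 `^ p * (germ_sum (jump_pow p f1) s l +
                                 germ_sum (jump_pow p f2) s l))); last first.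
  by rewrite ler_wpM2l ?powR_ge0 ?lerD.
elim: l s {s0 pl lT H1 H2} => [|t l IH] s /=; first by rewrite addr0 mulr0.
rewrite addrACA mulrDr lerD// /jump_pow.
have -> : f1 t - f2 t - (f1 s - f2 s) = (f1 t - f1 s) - (f2 t - f2 s).
  by rewrite !opprB addrACA [RHS]addrACA [X in _ + X = _]addrC.
set A := f1 t - f1 s; set B := f2 t - f2 s.
have half (c m : R) : 0 <= m -> c <= m -> 0 <= c ->
    (c + m) `^ p <= 2 `^ p * m `^ p.
  move=> m0 cm c0; rewrite -powRM//; apply: ge0_ler_powR;
    rewrite ?nnegrE ?(ltW p0)//.
  - exact: addr_ge0.
  - exact: mulr_ge0.
  - by lra.
have AB : `|A - B| `^ p <= (`|A| + `|B|) `^ p.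
  apply: ge0_ler_powR; rewrite ?nnegrE ?(ltW p0) ?addr_ge0//.
  exact: ler_normB.
apply: le_trans AB _.
have [AleB|/ltW BleA] := leP `|A| `|B|.
  apply: (le_trans (half _ _ (normr_ge0 B) AleB (normr_ge0 A))).
  by rewrite ler_wpM2l ?powR_ge0// lerDr powR_ge0.
rewrite [`|A| + _]addrC.
apply: (le_trans (half _ _ (normr_ge0 A) BleA (normr_ge0 B))).
by rewrite ler_wpM2l ?powR_ge0// lerDl powR_ge0.
Qed.

Lemma germ_sum_map {U : zmodType} (Xi : R -> R -> U) (h : R -> R) s l :
  germ_sum Xi (h s) (map h l) = germ_sum (fun u t => Xi (h u) (h t)) s l.
Proof. by elim: l s => //= t l IH s; rewrite IH. Qed.

Lemma eq_germ_sum {U : zmodType} (Xi Xi' : R -> R -> U) s l :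
  (forall u t, u \in s :: l -> t \in s :: l -> Xi u t = Xi' u t) ->
  germ_sum Xi s l = germ_sum Xi' s l.
Proof.
elim: l s => //= t l IH s XiE.
rewrite XiE ?inE ?eqxx ?orbT// IH// => u v ul vl.
by apply: XiE; rewrite inE ?ul ?vl orbT.
Qed.

(** The inverse is chosen pointwise from surjectivity; its values outside [0, T]
    are arbitrary. *)
Lemma time_change_inverse T (lam : R -> R) : 0 <= T -> time_change T lam ->
  exists2 mu, mu 0 = 0 & forall s t, 0 <= s <= T -> 0 <= t <= T ->
    [/\ 0 <= mu s <= T, lam (mu s) = s & s < t -> mu s < mu t].
Proof.
move=> T0 [[lamfun _ lamsurj] lam_incr].
have /choice[mu Hmu] : forall s, exists r,
    0 <= s <= T -> 0 <= r <= T /\ lam r = s.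
  move=> s; have [sT|] := boolP (0 <= s <= T); last by exists 0.
  have [|r] := lamsurj s; first by rewrite /= in_itv.
  by rewrite /= in_itv => rT <-; exists r.
have mon s t : 0 <= s <= T -> 0 <= t <= T -> s < t -> mu s < mu t.
  move=> sT tT st; have [msT ls] := Hmu s sT; have [mtT lt] := Hmu t tT.
  rewrite ltNge le_eqVlt; apply/negP => /orP[/eqP E|lts].
    by move: st; rewrite -ls -lt E ltxx.
  have := lam_incr (mu t) (mu s); rewrite !in_itv /= => /(_ mtT msT lts).
  by rewrite ls lt => /(lt_trans st); rewrite ltxx.
exists mu; last first.
  by move=> s t sT tT; have [msT ls] := Hmu s sT; split=> //; exact: mon.
have z0 : 0 <= (0 : R) <= T by rewrite lexx T0.
have [m0T l0] := Hmu 0 z0.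
have lam0 : 0 <= lam 0 <= T.
  by have := lamfun 0; rewrite /= !in_itv /= => /(_ z0).
apply/eqP; rewrite eq_le; have /andP[m0 _] := m0T; rewrite m0 andbT leNgt.
apply/negP => mgt; have := lam_incr 0 (mu 0);
  rewrite !in_itv /= => /(_ z0 m0T mgt).
by rewrite l0; case/andP: lam0 => [/le_lt_trans H _] /H; rewrite ltxx.
Qed.

Lemma pvar_le_time_change T p f lam W : 0 <= T -> time_change T lam ->
  pvar_le T p (fun t => f (lam t)) W -> pvar_le T p f W.
Proof.
move=> T0 /(time_change_inverse T0)[mu mu0 Hmu] HW s l s0 pl lT.
have inT u : u \in s :: l -> 0 <= u <= T.
  rewrite inE => /orP[/eqP ->|ul].
    by rewrite s0 (le_trans _ lT)// (path_last_le (fun _ _ => id) pl).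
  have /andP[su ule] := path_mem_le_last (fun _ _ => id) pl ul.
  by rewrite (le_trans s0 (ltW su)) (le_trans ule).
have -> : germ_sum (jump_pow p f) s l =
    germ_sum (jump_pow p (fun t => f (lam t))) (mu s) (map mu l).
  rewrite germ_sum_map; apply: eq_germ_sum => u t ul tl.
  rewrite /jump_pow; have [_ -> _] := Hmu u t (inT u ul) (inT t tl).
  by have [_ -> _] := Hmu t u (inT t tl) (inT u ul).
have sT := inT s (mem_head _ _).
apply: HW.
- by have [/andP[]] := Hmu s s sT sT.
- have : path (fun u t => mu u < mu t) s l.
    apply: (sub_in_path (P := fun u => 0 <= u <= T) (e := <%R)) pl => //.
      move=> u t uT tT ut; have [_ _] := Hmu u t uT tT; exact.
    exact/allP.
  by rewrite path_map.
- rewrite last_map; have lT' := inT _ (mem_last s l).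
  by have [/andP[]] := Hmu _ _ lT' lT'.
Qed.

End variation_stability.

(** * Points of small oscillation *)

Section small_oscillation.
Context {R : realType} {V : normedModType R}.
Implicit Types (T p W s t u : R) (f : R -> V) (l : seq R) (w : R -> R -> R).

(** By superadditivity one of the two halves of an interval carries at most half
    of its control. *)
Lemma control_halving T p f w s t n : is_control T p f w ->
  0 <= s -> s < t -> t <= T ->
  exists s' t', [/\ s <= s', s' < t', t' <= t & w s' t' <= w s t * 2^-1 ^+ n].
Proof.
move=> wc s0 st tT; elim: n => [|n [s' [t' [ss st' tt wle]]]].
  by exists s, t; split=> //; rewrite mulr1.
pose m := (s' + t') / 2.
have sm : s' < m by rewrite /m; lra.
have mt : m < t' by rewrite /m; lra.
have [wsup _ _] := wc.
have := wsup s' m t' (le_trans s0 ss) (ltW sm) (ltW mt) (le_trans tt tT) => wm.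
rewrite exprS [2^-1 * _]mulrC mulrA.
have [H|/ltW H] := leP (w s' m) (w m t').
  exists s', m; split=> //; first by rewrite (le_trans (ltW mt)).
  by lra.
exists m, t'; split=> //; first by rewrite (le_trans ss)// ltW.
by lra.
Qed.

Definition small_oscillation T f (eta r rho : R) :=
  forall u, 0 <= u <= T -> `|u - r| < rho -> `|f u - f r| <= eta.

(** The midpoint of a subinterval whose control is at most eta ^ p. *)
Lemma small_oscillation_dense T p f w s t eta : 1 <= p -> is_control T p f w ->
  0 <= s -> s < t -> t <= T -> 0 < eta ->
  exists r rho, [/\ s < r < t, 0 < rho & small_oscillation T f eta r rho].
Proof.
move=> p1 wc s0 st tT eta0; have p0 := lt_le_trans ltr01 p1.
have wst := control_ge0 wc s0 (ltW st) tT.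
have etap : 0 < eta `^ p by rewrite powR_gt0.
pose n := Num.truncn (w s t / eta `^ p).
have [s' [t' [ss st' tt wle]]] := control_halving n.+1 wc s0 st tT.
have {}wle : w s' t' <= eta `^ p.
  apply: le_trans wle _; rewrite exprVn ler_pdivrMr ?exprn_gt0//.
  rewrite mulrC -ler_pdivrMr//; apply: le_trans (ltW (truncnS_gt _)) _.
  by rewrite -natrX ler_nat ltnW// ltn_expl.
exists ((s' + t') / 2), ((t' - s') / 2); split; first by apply/andP; split; lra.
  by lra.
have small v1 v2 : s' <= v1 -> v1 <= v2 -> v2 <= t' -> `|f v2 - f v1| <= eta.
  move=> sv vv vt; have v0 := le_trans s0 (le_trans ss sv).
  have vT := le_trans vt (le_trans tt tT).
  apply: le_trans (control_jump p1 wc v0 vv vT) _.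
  have : w v1 v2 `^ p^-1 <= (eta `^ p) `^ p^-1.
    apply: ge0_ler_powR; rewrite ?nnegrE ?invr_ge0 ?(ltW p0) ?(ltW etap)//.
      exact: control_ge0 wc _ _ _.
    apply: le_trans wle.
    exact: control_mono wc (le_trans s0 ss) sv vv vt (le_trans tt tT).
  by rewrite -powRrM mulfV ?gt_eqF// powRr1// ltW.
move=> u _; rewrite ltr_norml => /andP[ul ur].
have [ur'|/ltW ur'] := leP u ((s' + t') / 2).
  by rewrite distrC; apply: small => //; lra.
by apply: small => //; lra.
Qed.

(** The number of points is bounded in terms of the mesh alone, so that eta may
    be chosen afterwards, depending on this number. *)
Lemma small_oscillation_partition T p f w eta delta :
  1 <= p -> is_control T p f w -> 0 < T -> 0 < eta -> 0 < delta ->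
  exists l rho, [/\ path (step_lt delta) 0 l, last 0 l = T,
    (size l <= (Num.truncn (T / (delta / 2))).+1)%N, 0 < rho &
    forall r, r \in l -> r < T -> small_oscillation T f eta r rho].
Proof.
move=> p1 wc T0 eta0 d0.
suff H n s : 0 <= s -> s < T -> T - s < n%:R * (delta / 2) ->
    exists l rho, [/\ path (step_lt delta) s l, last s l = T,
    (size l <= n)%N, 0 < rho &
    forall r, r \in l -> r < T -> small_oscillation T f eta r rho].
  apply: (H (Num.truncn (T / (delta / 2))).+1 0) => //.
  by rewrite subr0 -ltr_pdivrMr ?truncnS_gt// divr_gt0.
elim: n s => [|n IH] s s0 sT; first by rewrite mul0r; lra.
rewrite mulrSr mulrDl mul1r => HT.
have [Ts|Ts] := ltP (T - s) delta.
  exists [:: T], 1; split=> //=; first by rewrite /step_lt sT Ts.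
  by move=> r; rewrite inE => /eqP ->; rewrite ltxx.
have [r [rho [/andP[sr rd] rho0 Hr]]] :=
  @small_oscillation_dense T p f w (s + delta / 2) (s + delta) eta p1 wc
    ltac:(lra) ltac:(lra) ltac:(lra) eta0.
have [|||l [rho' [pl el ln rho'0 Hl]]] := IH r; [lra|lra|lra|].
exists (r :: l), (Num.min rho rho'); split=> //=.
- by rewrite pl andbT /step_lt; apply/andP; split; lra.
- by rewrite lt_min rho0.
- move=> r'; rewrite inE => /orP[/eqP -> _|r'l r'T] u uT;
    rewrite lt_min => /andP[u1 u2]; [exact: Hr|exact: Hl].
Qed.

End small_oscillation.

(** * Time changes close to the identity *)

Section time_change_estimates.
Context {R : realType}.

Lemma dist1_le_expR (q delta : R) : 0 < q -> `|ln q| < delta ->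
  `|q - 1| <= expR delta - 1.
Proof.
move=> q0; rewrite ltr_norml => /andP[lo up].
have up' : q <= expR delta by rewrite -[q]lnK ?posrE// ler_expR ltW.
have lo' : expR (- delta) <= q by rewrite -[q]lnK ?posrE// ler_expR ltW.
have := expR_ge1Dx (- delta); have := expR_ge1Dx delta.
rewrite ler_norml => H1 H2; apply/andP; split; lra.
Qed.

Lemma time_change0 (T : R) lam : 0 <= T -> time_change T lam -> lam 0 = 0.
Proof.
move=> T0 tc; have [mu mu0 Hmu] := time_change_inverse T0 tc.
have z0 : 0 <= (0 : R) <= T by rewrite lexx.
by have [_ + _] := Hmu 0 0 z0 z0; rewrite mu0.
Qed.

Lemma time_change_near_id (T delta : R) lam : 0 <= T -> 0 < delta ->
  time_change T lam -> (time_change_norm T lam < delta%:E)%E ->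
  forall r, 0 <= r <= T -> `|lam r - r| <= T * (expR delta - 1).
Proof.
move=> T0 delta0 tc nd r /andP[r0 rT].
have lam0 := time_change0 T0 tc.
have ed : 0 <= expR delta - 1.
  by rewrite subr_ge0; apply: le_trans (expR_ge1Dx _); rewrite lerDl ltW.
have [->|rN0] := eqVneq r 0; first by rewrite lam0 subrr normr0 mulr_ge0.
have {}r0 : 0 < r by rewrite lt_neqAle eq_sym rN0.
have lr0 : 0 < lam r.
  by have [_ lam_incr] := tc; rewrite -lam0; apply: lam_incr => //;
    rewrite in_itv /= ?lexx// (ltW r0).
have : `|ln (lam r / r)| < delta.
  rewrite -lte_fin; apply: le_lt_trans nd; apply: ereal_sup_ubound.
  exists 0, r; rewrite !in_itv /= lexx T0 (ltW r0) rT lam0 !subr0; split=> //.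
  by rewrite eq_sym.
move=> /(dist1_le_expR (divr_gt0 lr0 r0)) Hq.
have -> : lam r - r = r * (lam r / r - 1) by field.
by rewrite normrM (gtr0_norm r0) ler_pM// ltW.
Qed.

End time_change_estimates.

(** * Uniform smallness of the integral *)

Section young_stability.
Context {R : realType} {d e : nat}.
Variables (T p a H : R) (x : R -> 'cV[R]_d).
Hypothesis T_gt0 : 0 < T.
Hypothesis p_ge1 : 1 <= p.
Hypothesis a_gt0 : 0 < a.
Hypothesis young_cond : 1 < a + p^-1.
Hypothesis H_ge0 : 0 <= H.
Hypothesis x_holder : forall s t : R, 0 <= s -> s <= t -> t <= T ->
  `|x t - x s| <= H * (t - s) `^ a.
Implicit Types (f v : R -> 'M[R]_(e, d)) (w : R -> R -> R) (s t : R).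

(** The mesh h is chosen first, from W and M; the Riemann sum over a subdivision
    with at most N blocks, each at most c = M / (2 N), then bounds the
    integral up to M / 2. *)
Lemma young_integral_small v wv W M : is_control T p v wv -> 0 <= W -> 0 < M ->
  exists2 delta, 0 < delta & forall u w (mu : R -> R),
    is_control T p (fun t => v t - u t) w -> w 0 T <= W -> mu 0 = 0 ->
    (forall t, 0 <= t <= T ->
       [/\ 0 <= mu t <= T, `|mu t - t| < delta & `|v (mu t) - u t| <= delta]) ->
    forall t, 0 <= t <= T -> `|young_integral (fun t => v t - u t) x t| <= M.
Proof.
move=> vc W0 M0; have M20 : 0 < M / 2 by rewrite divr_gt0.
have C0 : 0 <= young_const p a H (d := d) := young_const_ge0 young_cond H_ge0.
have g0 : 0 < a + p^-1 - 1 by rewrite subr_gt0.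
have [h h0 Hh] := powR_small C0 W0 g0 M20.
pose c0 := d%:R * (H * T `^ a) + 1.
have c0_gt0 : 0 < c0.
  by rewrite ltr_wpDl// mulr_ge0// mulr_ge0// powR_ge0.
pose N := (Num.truncn (T / (h / 2))).+1.
pose c := M / 2 / N%:R.
have c_gt0 : 0 < c by rewrite divr_gt0// ltr0n.
have eta0 : 0 < c / c0 / 2 by rewrite !divr_gt0.
(* The oscillation of v and the distance from u each account for half of
   c / c0, where c0 bounds the factor that multiplies |f r| in a block. *)
have [l [rho [pl el ln rho0 Hl]]] :=
  small_oscillation_partition p_ge1 vc T_gt0 eta0 h0.
exists (Num.min rho (c / c0 / 2)); first by rewrite lt_min rho0.
move=> u w mu; set f := fun t => v t - u t => fc wW mu0 Hmu t tT.
have f_small r : r \in 0 :: l -> 0 <= r < T -> `|f r| <= c / c0.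
  move=> rl /andP[r0 rT]; have rT' : 0 <= r <= T by rewrite r0 ltW.
  have [muT]:= Hmu r rT'; rewrite lt_min le_min => /andP[mur _] /andP[_ err].
  have -> : f r = (v (mu r) - u r) - (v (mu r) - v r).
    by rewrite /f opprB [RHS]addrC subrKA.
  apply: le_trans (ler_normB _ _) _.
  suff : `|v (mu r) - v r| <= c / c0 / 2 by lra.
  move: rl; rewrite inE => /orP[/eqP ->|rl]; last exact: Hl.
  by rewrite mu0 subrr normr0 ltW.
have germ_small r u' : r \in 0 :: l -> r < u' -> u' <= last 0 l ->
    `|young_germ x f r u'| <= c.
  rewrite el => rl ru uT; have r0 : 0 <= r.
    move: rl; rewrite inE => /orP[/eqP ->//|rl].
    by have /andP[/ltW] := path_mem_le_last (@step_lt_lt R h) pl rl.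
  have rT := lt_le_trans ru uT.
  apply: le_trans (young_germ_le x_holder f r0 (ltW ru) uT) _.
  have -> : c = c / c0 * c0 by rewrite divfK ?gt_eqF.
  have : `|f r| <= c / c0 by apply: f_small => //; rewrite r0.
  have Ha : H * (u' - r) `^ a <= H * T `^ a.
    rewrite ler_wpM2l//; apply: ge0_ler_powR; rewrite ?nnegrE ?(ltW a_gt0)//;
      lra.
  move=> fr; rewrite mulrAC mulrC.
  apply: ler_pM; rewrite ?normr_ge0//.
    by rewrite mulr_ge0// mulr_ge0// powR_ge0.
  by rewrite /c0 ler_wpDr// ler_wpM2l.
have [t0|tN0] := eqVneq t 0.
  have := young_approx p_ge1 a_gt0 young_cond H_ge0 x_holder fc tT (l := [::]).
  by rewrite t0 /= subr0 => /(_ isT erefl)/le_trans; apply; exact: ltW.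
have /andP[t0 tT'] := tT.
have {}t0 : 0 < t by rewrite lt_neqAle eq_sym tN0.
have [||l' [pl' el' Hl']] := truncated_partition (e := step_lt h)
  (@step_lt_lt R h) _ (ltW c_gt0) pl t0 _ germ_small.
- move=> r u1 u2 /andP[ru uh] ru2 u21; apply/andP; split=> //.
  by apply: le_lt_trans uh; rewrite lerD2r.
- by rewrite el.
have pl'' := sub_path (@step_lt_lt R h) pl'.
have A1 := young_approx p_ge1 a_gt0 young_cond H_ge0 x_holder fc tT pl'' el'.
have := young_mesh p_ge1 young_cond H_ge0 fc (ltW h0) pl'.
rewrite el' => /(_ tT') A2.
have A3 : (size l)%:R * c <= M / 2.
  have -> : M / 2 = N%:R * c by rewrite /c [RHS]mulrC divfK// pnatr_eq0.
  by rewrite ler_wpM2r ?(ltW c_gt0)// ler_nat.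
have A4 : young_const p a H (d := d) * h `^ (a + p^-1 - 1) * w 0 T <= M / 2.
  by apply: le_trans Hh; rewrite ler_wpM2l// mulr_ge0// powR_ge0.
set I := young_integral f x t in A1 *; set S := germ_sum _ _ _ in A1 Hl'.
have : `|I| <= `|I - S| + `|S| by rewrite -{1}(subrK S I) ler_normD.
lra.
Qed.
End young_stability.

(** * Suprema defining the norms and the distance *)

Section extended_norms.
Context {R : realType} {V : normedModType R}.
Implicit Types (T p a : R) (x : R -> V).

Lemma holder_spaceP T a x : 0 < a -> holder_space T a x ->
  exists2 H, 0 <= H & forall s t : R, 0 <= s -> s <= t -> t <= T ->
    `|x t - x s| <= H * (t - s) `^ a.
Proof.
move=> a0 xH.
suff [c Hc] : exists c : R, (holder_const T a x <= c%:E)%E.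
  exists `|c| => // s t s0 st tT.
  have [<-|sNt] := eqVneq s t.
    by rewrite !subrr normr0 mulr_ge0// powR_ge0.
  have {}st : s < t by rewrite lt_neqAle sNt.
  have ts : 0 < (t - s) `^ a by rewrite powR_gt0// subr_gt0.
  rewrite -ler_pdivrMr//; apply: (@le_trans _ _ c); last exact: ler_norm.
  rewrite -lee_fin; apply: le_trans Hc; apply: ereal_sup_ubound.
  exists s, t; rewrite !in_itv /= s0 tT (le_trans (ltW st) tT).
  rewrite (le_trans s0 (ltW st)).
  by split=> //; rewrite (gtr0_norm (_ : 0 < t - s)) ?subr_gt0.
move: xH; rewrite /holder_space /=.
case: (holder_const T a x) => [r _|//|_]; first by exists r.
by exists 0; rewrite leNye.
Qed.

Lemma holder_const_le T a x c :
  (forall s t, 0 <= s -> s < t -> t <= T -> `|x t - x s| <= c * (t - s) `^ a) ->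
  (holder_const T a x <= c%:E)%E.
Proof.
move=> Hc; apply: ge_ereal_sup => _ [s [t [sT tT sNt ->]]].
move: sT tT; rewrite !in_itv /= => /andP[s0 sT] /andP[t0 tT].
rewrite lee_fin; have [st|ts|E] := ltgtP s t; last by rewrite E eqxx in sNt.
  rewrite gtr0_norm ?subr_gt0// ler_pdivrMr ?powR_gt0 ?subr_gt0//.
  exact: Hc.
rewrite distrC [`|t - s|]distrC gtr0_norm ?subr_gt0//.
by rewrite ler_pdivrMr ?powR_gt0 ?subr_gt0//; exact: Hc.
Qed.

Lemma sup_norm_le T x c : (forall t, 0 <= t <= T -> `|x t| <= c) ->
  (sup_norm T x <= c%:E)%E.
Proof.
move=> Hc; apply: ge_ereal_sup => _ [t /= tT <-].
by rewrite lee_fin Hc.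
Qed.

Lemma var_norm_lt T p x delta : 0 <= T -> (var_norm T p x < delta%:E)%E ->
  (p_variation T p x < delta%:E)%E /\ forall t, 0 <= t <= T -> `|x t| < delta.
Proof.
move=> T0 Hlt.
have sup_ge t : 0 <= t <= T -> (`|x t|%:E <= sup_norm T x)%E.
  by move=> tT; apply: ereal_sup_ubound; exists t => //=; rewrite in_itv.
have pv_ge0 : (0 <= p_variation T p x)%E.
  apply: (@le_trans _ _ (0 `^ p^-1)%:E); first by rewrite lee_fin powR_ge0.
  apply: ereal_sup_ubound; exists 0%N, (fun=> 0); split=> //.
    by move=> k _; rewrite in_itv /= lexx.
  by rewrite big_geq.
have sn_ge0 : (0 <= sup_norm T x)%E.
  by apply: le_trans (sup_ge 0 _); rewrite ?lee_fin// lexx.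
split; first by apply: le_lt_trans Hlt; rewrite leeDr.
move=> t tT; rewrite -lte_fin; apply: le_lt_trans Hlt.
by apply: le_trans (sup_ge t tT) _; rewrite leeDl.
Qed.

End extended_norms.

Lemma skorokhod_dist_lt {R : realType} {V : normedModType R} (T p : R)
    (v u : R -> V) delta :
  (skorokhod_dist T p v u < delta%:E)%E -> exists lam,
  [/\ time_change T lam, (time_change_norm T lam < delta%:E)%E &
      (var_norm T p (fun t => v t - u (lam t))%R < delta%:E)%E].
Proof.
move=> /ereal_inf_lt[_ [lam tc <-]]; rewrite gt_max => /andP[H1 H2].
by exists lam.
Qed.

(** * Continuity of Young integration *)

Theorem mainTheorem5 (R : realType) (T : R) (d e : nat) (p a : R)
    (x : R -> 'cV[R]_d)
    (T_gt0 : 0 < T) (d_ge1 : (1 <= d)%N) (e_ge1 : (1 <= e)%N)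
    (p_ge1 : 1 <= p) (a_gt0 : 0 < a) (a_le1 : a <= 1)
    (young_cond : 1 < a + p^-1)
    (x_holder : holder_space T a x) :
  (forall v : R -> 'M[R]_(e, d), var_space T p v ->
     (forall t : R, t \in `[0, T] ->
        cvg (young_sum v x s @[s --> vanishing_mesh t])) /\
     holder_space T a (young_integral v x)) /\
  (forall b : R, 0 < b < a ->
     forall v : R -> 'M[R]_(e, d), var_space T p v ->
     forall eps : R, 0 < eps ->
     exists2 delta : R, 0 < delta &
       forall w : R -> 'M[R]_(e, d), var_space T p w ->
         (skorokhod_dist T p v w < delta%:E)%E ->
         (holder_norm T b
            (fun t => young_integral v x t - young_integral w x t)%R
          < eps%:E)%E).
Proof.
have [H H0 xH] := holder_spaceP a_gt0 x_holder.
have T0 := ltW T_gt0.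
have controlled (f : R -> 'M[R]_(e, d)) :
    var_space T p f -> exists2 w, is_control T p f w &
      exists W, pvar_le T p f W.
  move=> [_ /(p_variation_fin p_ge1)[W HW]].
  by have [w wc _] := exists_control p_ge1 T0 HW; exists w => //; exists W.
have cvg_young (f : R -> 'M[R]_(e, d)) t : var_space T p f -> 0 <= t <= T ->
    cvg (young_sum f x s @[s --> vanishing_mesh t]).
  move=> fV tT; have [w wc _] := controlled f fV.
  exact: (young_cvg p_ge1 a_gt0 young_cond H0 xH wc tT).
split=> [v vV|b /andP[b0 ba] v vV eps eps0].
  split=> [t|]; first by rewrite in_itv; exact: cvg_young.
  have [w wc _] := controlled v vV.
  rewrite /holder_space /=.
  apply: le_lt_trans (holder_const_le _) (ltry _) => s t s0 st tT.
  exact: (young_holder p_ge1 a_gt0 young_cond H0 xH wc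
            (lexx _) (lexx _) s0 st tT).
have [wv vc [Wv HWv]] := controlled v vV.
have Wv0 : 0 <= Wv := pvar_le_ge0 T0 HWv.
(* Wu bounds the variation of u, since u o lam = v - (v - u o lam), where the
   p-variation of the second term is at most 1; W bounds the control of v - u,
   its summand T coming from the length included in a control. *)
pose Wu := 2 `^ p * (Wv + 1); pose W := 2 `^ p * (Wv + Wu) + T.
have Wu0 : 0 <= Wu by rewrite mulr_ge0 ?powR_ge0// addr_ge0.
have W0 : 0 <= W by rewrite addr_ge0// mulr_ge0 ?powR_ge0// addr_ge0.
pose K := young_const p a H (d := d) * W `^ p^-1 + d%:R * (1 + W `^ p^-1) * H.
have K0 : 0 <= K.
  apply: addr_ge0; apply: mulr_ge0 => //.
  - exact: young_const_ge0.
  - exact: powR_ge0.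
  - by rewrite mulr_ge0// addr_ge0// powR_ge0.
have ab0 : 0 < a - b by rewrite subr_gt0.
have e40 : 0 < eps / 4 by rewrite divr_gt0.
have [h h0 Hh] := powR_small K0 ler01 ab0 e40.
have hb0 : 0 < h `^ b := powR_gt0 _ h0.
(* If |I| <= M, then |I t - I s| <= 2 M <= (eps / 4) (t - s) ^ b as soon as
   h <= t - s. *)
pose M := Num.min (eps / 4) (eps / 8 * h `^ b).
have M0 : 0 < M by rewrite lt_min e40 mulr_gt0// divr_gt0.
have [delta1 delta10 Hsmall] :=
  young_integral_small T_gt0 p_ge1 a_gt0 young_cond H0 xH vc W0 M0.
(* delta2 is such that a time change of norm below it moves points by at most
   delta1 / 2. *)
pose delta2 := ln (1 + delta1 / 2 / T).
have delta1T : 0 < delta1 / 2 / T by rewrite !divr_gt0.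
have delta20 : 0 < delta2 by rewrite ln_gt0// ltrDl.
have expR_delta2 : T * (expR delta2 - 1) = delta1 / 2.
  by rewrite lnK ?posrE ?addr_gt0// addrAC subrr add0r mulrC divfK ?gt_eqF.
pose delta := Num.min 1 (Num.min delta1 delta2).
have delta0 : 0 < delta by rewrite !lt_min ltr01 delta10.
have delta_le1 : delta <= 1 by rewrite ge_min lexx.
have delta_le_delta1 : delta <= delta1 by rewrite !ge_min lexx orbT.
have delta_le_delta2 : delta <= delta2 by rewrite !ge_min lexx !orbT.
exists delta => // u uV /skorokhod_dist_lt[lam [tc lamd]].
move=> /(var_norm_lt T0)[gvar gsup].
have HWu : pvar_le T p u Wu.
  apply: (pvar_le_time_change T0 tc).
  have Hg : pvar_le T p (fun t => v t - u (lam t)) (1 `^ p).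
    apply: p_variation_le => //; apply: le_trans (ltW gvar) _.
    by rewrite lee_fin.
  rewrite powR1 in Hg.
  have -> : (fun t => u (lam t)) = (fun t => v t - (v t - u (lam t))).
    by apply/funext => t; rewrite subKr.
  exact: pvar_le_sub HWv Hg.
have [w wc wW] := exists_control p_ge1 T0 (pvar_le_sub p_ge1 HWv HWu).
have [mu mu0 Hmu] := time_change_inverse T0 tc.
have z0 : 0 <= (0 : R) <= T by rewrite lexx.
have {}Hsmall : forall t, 0 <= t <= T ->
    `|young_integral (fun t => v t - u t) x t| <= M.
  apply: (Hsmall u w mu wc wW mu0) => t tT.
  have [muT lmu _] := Hmu t t tT tT; split=> //.
    have := time_change_near_id T0 delta0 tc lamd muT; rewrite lmu distrC.
    move=> /le_lt_trans; apply.
    apply: (@le_lt_trans _ _ (T * (expR delta2 - 1))).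
      by rewrite ler_wpM2l// lerD2r ler_expR.
    by rewrite expR_delta2; lra.
  by have := gsup _ muT; rewrite lmu => /ltW/le_trans; apply.
pose I := young_integral (fun t => v t - u t) x.
have IE t : 0 <= t <= T -> young_integral v x t - young_integral u x t = I t.
  move=> tT; have /andP[t0 _] := tT; have PF := vanishing_mesh_proper t0.
  rewrite /young_integral -limB;
    [|exact: cvg_young vV tT|exact: cvg_young uV tT].
  rewrite (_ : _ - _ = young_sum (fun t => v t - u t) x)//.
  apply/funext => l; rewrite -[LHS]/(young_sum v x l - young_sum u x l) -sumrB.
  by apply: eq_bigr => k _; rewrite mulmxBl.
have f0_le1 : `|v 0 - u 0| <= 1.
  have := gsup 0 z0; rewrite (time_change0 T0 tc); lra.
have IH : forall s t, 0 <= s -> s < t -> t <= T ->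
    `|I t - I s| <= K * (t - s) `^ a.
  move=> s t s0 st tT.
  exact: (young_holder p_ge1 a_gt0 young_cond H0 xH wc wW f0_le1 s0 st tT).
have sup_le : (sup_norm T
      (fun t => young_integral v x t - young_integral u x t)%R <= (eps / 4)%:E)%E.
  apply: sup_norm_le => t tT; rewrite IE//.
  by apply: le_trans (Hsmall t tT) _; rewrite ge_min lexx.
have hol_le : (holder_const T b
      (fun t => young_integral v x t - young_integral u x t)%R <= (eps / 4)%:E)%E.
  apply: holder_const_le => s t s0 st tT.
  have sT' : 0 <= s <= T by rewrite s0 (le_trans (ltW st)).
  have tT' : 0 <= t <= T by rewrite tT (le_trans s0 (ltW st)).
  have ts0 : 0 < t - s by rewrite subr_gt0.
  rewrite !IE//.
  have [tsh|hts] := leP (t - s) h.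
    apply: le_trans (IH s t s0 st tT) _.
    have -> : (t - s) `^ a = (t - s) `^ (a - b) * (t - s) `^ b.
      by rewrite -powRD ?subrK// (gt_eqF ts0) implybT.
    rewrite mulrA ler_wpM2r ?powR_ge0//; apply: le_trans Hh; rewrite mulr1.
    rewrite ler_wpM2l//; apply: ge0_ler_powR; rewrite ?nnegrE ?(ltW ab0)//; lra.
  have MI : M <= eps / 8 * h `^ b by rewrite ge_min lexx orbT.
  have := ler_normB (I t) (I s); have := Hsmall s sT'; have := Hsmall t tT'.
  have : eps / 4 * h `^ b <= eps / 4 * (t - s) `^ b.
    rewrite ler_wpM2l ?(ltW e40)//.
    by apply: ge0_ler_powR; rewrite ?nnegrE ?(ltW b0)//; lra.
  rewrite -/I; lra.
apply: (@le_lt_trans _ _ ((eps / 4)%:E + (eps / 4)%:E)%E).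
  by rewrite /holder_norm leeD.
by rewrite -EFinD lte_fin; lra.
Qed.
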